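(* Let $T_1$ and $T_2$ be maps whose dynamical zeta functions $\zeta_{T_1}$ and $\zeta_{T_2}$ are non-degenerate rational functions. Then $\rho(\zeta_{T_1^k})=\rho(\zeta_{T_1})^k$ for every integer $k\ge 1$, and $\rho(\zeta_{T_1\times T_2})=\rho(\zeta_{T_1})\,\rho(\zeta_{T_2})$.
   Context: A map means a map $T:X\to X$ of a set (e.g. a continuous map of a compact metric space). A closed orbit of length $n$ is a set $\{x,Tx,\dots,T^{n}x=x\}$ of cardinality $n$; $\mathsf{O}_T(n)$ is the number of closed orbits of length $n$, and it is always assumed that $\mathsf{O}_T(n)<\infty$ for all $n\ge1$. Let $\mathsf{F}_T(n)=\sum_{d\mid n}d\,\mathsf{O}_T(d)$ be the number of points fixed by $T^n$. The dynamical zeta function is $\zeta_T(z)=\exp\sum_{n=1}^{\infty}\mathsf{F}_T(n)\frac{z^n}{n}$, with radius of convergence $\rho(\zeta_T)=1/\limsup_{n\to\infty}\mathsf{F}_T(n)^{1/n}$. $T_1^k$ is the $k$-th iterate of $T_1$, and $T_1\times T_2$ is the Cartesian product map $(x,y)\mapsto(T_1x,T_2y)$, so that $\mathsf{F}_{T_1^k}(n)=\mathsf{F}_{T_1}(kn)$ and $\mathsf{F}_{T_1\times T_2}(n)=\mathsf{F}_{T_1}(n)\mathsf{F}_{T_2}(n)$. A linear recurrence sequence is non-degenerate if no ratio of two distinct zeros of its characteristic polynomial (that of its minimal recurrence) is a root of unity. A rational zeta function $\zeta_T$ is called non-degenerate if the sequence $(\mathsf{F}_T(n))_{n\ge1}$,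 which is then a linear recurrence sequence, is non-degenerate. *)

(* Defs.v *)
From HB Require Import structures.
From mathcomp Require Import all_boot all_order all_algebra.
From mathcomp Require Import all_classical all_reals all_analysis.
From mathcomp Require Import finmap complex.

Set Implicit Arguments.
Unset Strict Implicit.
Unset Printing Implicit Defensive.
Import Order.TTheory GRing.Theory Num.Theory.
Local Open Scope classical_set_scope.
Local Open Scope ring_scope.

Definition closed_orbit (X : Type) (T : X -> X) (n : nat) (A : set X) : Prop :=
  exists x : X, [/\ iter n T x = x,
    A = [set iter i T x | i in [set i | (i <= n)%N]] & (A #= `I_n)%card].

Definition finite_orbits (X : Type) (T : X -> X) : Prop :=
  forall n : nat, (0 < n)%N -> finite_set [set A | closed_orbit T n A].

(* [fset_set] is empty on infinite sets, so this is the number of closed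
   orbits only under [finite_orbits T]. *)
Definition orbit_count (X : Type) (T : X -> X) (n : nat) : nat :=
  #|` fset_set [set A | closed_orbit T n A]|%fset.

(* [divisors 0 = [::]], so [fix_count T 0 = 0]; only n >= 1 is meaningful. *)
Definition fix_count (X : Type) (T : X -> X) (n : nat) : nat :=
  (\sum_(d <- divisors n) d * orbit_count T d)%N.

(* Formal power series are represented by their coefficient sequences. *)

(* For f with f 0 = 0 the powers f^j, j > n, do not contribute to the
   coefficient of z^n in exp f, and neither do the coefficients f i, i > n. *)
Definition fps_exp (K : fieldType) (f : nat -> K) (n : nat) : K :=
  \sum_(j < n.+1) ((\poly_(i < n.+1) f i) ^+ j)`_n / j`!%:R.

(* The constant term of the exponent is fix_count T 0 / 0 = 0. *)
Definition zeta (K : fieldType) (X : Type) (T : X -> X) : nat -> K :=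
  fps_exp (fun n => (fix_count T n)%:R / n%:R).

(* Q f = P as formal power series. *)
Definition fps_rational (K : fieldType) (f : nat -> K) : Prop :=
  exists P Q : {poly K}, Q != 0 /\
    forall n : nat, \sum_(i < n.+1) Q`_i * f (n - i)%N = P`_n.

(* Sequences are indexed by n >= 1: the term u 0 is ignored. *)
Definition satisfies_recurrence (K : fieldType) (u : nat -> K) (p : {poly K})
    : Prop :=
  forall n : nat, (0 < n)%N -> \sum_(i < size p) p`_i * u (n + i)%N = 0.

Definition minimal_char_poly (K : fieldType) (u : nat -> K) (p : {poly K})
    : Prop :=
  [/\ p \is monic, satisfies_recurrence u p &
    forall q : {poly K}, q \is monic -> satisfies_recurrence u q ->
      (size p <= size q)%N].

(* K is meant to be algebraically closed, so that it contains all the zeros of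
   the characteristic polynomial. *)
Definition nondegenerate_lrs (K : closedFieldType) (u : nat -> K) : Prop :=
  exists p : {poly K}, minimal_char_poly u p /\
    forall a b : K, root p a -> root p b -> a != b ->
      forall m : nat, (0 < m)%N -> (a / b) ^+ m != 1.

Definition nondegenerate_rational_zeta (R : realType) (X : Type) (T : X -> X)
    : Prop :=
  fps_rational (@zeta R[i] X T) /\
  nondegenerate_lrs (fun n => (fix_count T n)%:R : R[i]).

(* Here 0^-1 = +oo and +oo^-1 = 0; the radius is +oo for an identically zero
   [fix_count T]. *)
Definition zeta_radius (R : realType) (X : Type) (T : X -> X) : \bar R :=
  ((limn_esup (fun n : nat => (((fix_count T n)%:R : R) `^ n%:R^-1)%:E))^-1)%E.

Definition prod_map (X Y : Type) (S : X -> X) (T : Y -> Y) : X * Y -> X * Y :=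
  fun xy => (S xy.1, T xy.2).

(* Main.v *)
Require Import Defs.
From HB Require Import structures.
From mathcomp Require Import all_boot all_order all_algebra.
From mathcomp Require Import all_classical all_reals all_analysis.
From mathcomp Require Import complex.
From mathcomp Require Import finmap zify ring.

(** The logarithmic derivative of a rational zeta function gives, for n >= 1,
F(n) as a sum of m_a a^n over finitely many distinct nonzero a with m_a <> 0.
These a are zeros of the characteristic polynomial, so no ratio of two of them
is a root of unity.  If such a sum has a frequency a0 of maximal modulus that
differs from all the other ones, then applying the product of the S - a, a <> a0,
where S is the shift, leaves a nonzero multiple of a0^n; hence the limsup of
the n-th roots is exactly |a0|.

For the k-th iterate the frequencies are the a^k, which remain distinct.  For
the product they are the a b, which may coincide and cancel, but not all of
those of maximal modulus do: modulo torsion, the frequencies of maximal modulus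
of the two factors live in a torsion-free, hence orderable, abelian group, and
the product of their maxima for such an order is attained only once.  This
avoids the deep lower bounds for the growth of non-degenerate recurrences. *)

Set Implicit Arguments.
Unset Strict Implicit.
Unset Printing Implicit Defensive.
Import Order.TTheory GRing.Theory Num.Theory.
Import numFieldNormedType.Exports.
Local Open Scope classical_set_scope.
Local Open Scope ring_scope.

(** * Periodic points *)

Section PeriodicPoints.
Local Open Scope nat_scope.
Variables (X : Type) (T : X -> X).

Definition fixed_points (n : nat) : set X := [set x | iter n T x = x].

(** All iterates are taken, without reference to a period, so that a closed orbit equals
    [orbit_of x] for each of its points [x]. *)
Definition orbit_of (x : X) : set X := range (fun i => iter i T x).

Lemma iter_fixed_mul n m x : iter n T x = x -> iter (m * n) T x = x.
Proof. by move=> e; elim: m => // m IH; rewrite mulSn iterD IH. Qed.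

Lemma iter_fixed_dvd d n x : iter d T x = x -> d %| n -> iter n T x = x.
Proof. by move=> e /dvdnP[m ->]; apply: iter_fixed_mul. Qed.

Lemma iter_fixed_mod n i x : iter n T x = x -> iter i T x = iter (i %% n) T x.
Proof.
by move=> e; rewrite {1}(divn_eq i n) addnC iterD iter_fixed_mul.
Qed.

Lemma closed_orbit_orbit d A x : closed_orbit T d A -> A x ->
  A = orbit_of x /\ fixed_points d x.
Proof.
case=> y [yd -> /=].
(* Length 0 cannot occur: [A] contains [y], whereas [I_0] is empty. *)
have [->|d0 _] := posnP d.
  by rewrite II0 card_eq0 => /eqP/seteqP[+ _]; move/(_ y); case; exists 0.
case=> j /= jd <-; split; last by rewrite /fixed_points /= -iterD addnC iterD yd.
apply/seteqP; split=> z [i i_ <-].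
  (* The point in hand is T^j y; j d - j further steps lead back to y, which T^(j d) fixes. *)
  exists (i + (j * d - j)) => //=; rewrite -iterD -addnA subnK ?leq_pmulr//.
  by rewrite iterD iter_fixed_mul.
exists ((i + j) %% d) => /=; first by rewrite ltnW// ltn_mod.
by rewrite -iterD [RHS](iter_fixed_mod _ yd).
Qed.

Lemma orbit_closed n x : 0 < n -> fixed_points n x ->
  exists2 d, d %| n & closed_orbit T d (orbit_of x).
Proof.
move=> n0 xn.
(* The length of the orbit is the least period [d] of [x], which divides [n] because the remainder
   would be a smaller period. *)
have Pex : exists d, (0 < d) && `[< iter d T x = x >].
  by exists n; rewrite n0; apply/asboolP.
case: (ex_minnP Pex) => d /andP[d0 /asboolP xd] dmin.
exists d.
  rewrite /dvdn eqn0Ngt; apply/negP => m0.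
  have: d <= n %% d.
    by apply: dmin; rewrite m0; apply/asboolP; rewrite -(iter_fixed_mod n xd).
  by rewrite leqNgt ltn_mod d0.
have orbE : orbit_of x = [set iter i T x | i in `I_d].
  apply/seteqP; split=> z [i i_ <-]; last by exists i.
  by exists (i %% d); rewrite /= ?ltn_mod// -(iter_fixed_mod _ xd).
exists x; split=> //; last first.
  rewrite orbE; apply: inj_card_eq => i j /set_mem /= id /set_mem /= jd.
  wlog ij : i j id jd / i <= j => [H|].
    by case/orP: (leq_total i j) => ? e; [|symmetry]; apply: H.
  move=> e; apply/eqP; rewrite eqn_leq ij /= leqNgt; apply/negP => ltij.
  (* If T^i x = T^j x with i < j < d, then d - (j - i) is a positive period below d. *)
  have /dmin : (0 < d - (j - i)) && `[< iter (d - (j - i)) T x = x >].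
    rewrite subn_gt0 (leq_ltn_trans (leq_subr _ _))//=; apply/asboolP.
    rewrite -[RHS]xd; have -> : d - (j - i) = (d - j) + i by lia.
    by rewrite iterD e -iterD subnK// ltnW.
  by lia.
apply/seteqP; split=> z [i i_ <-]; last by exists i.
exists (i %% d); rewrite /= -?(iter_fixed_mod _ xd)//.
by rewrite ltnW// ltn_mod.
Qed.

Lemma finite_fixed_points n : finite_orbits T -> 0 < n ->
  finite_set (fixed_points n).
Proof.
move=> fin n0.
apply: (@sub_finite_set _ _
  (\bigcup_(d in [set d | d \in divisors n])
     \bigcup_(A in [set A | closed_orbit T d A]) A)).
  move=> x /(orbit_closed n0)[d dn od]; exists d; first by rewrite /= -dvdn_divisors.
  by exists (orbit_of x) => //; exists 0.
apply: bigcup_finite => [|d /= dn]; first exact: finite_seq.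
have d0 : 0 < d by apply: (dvdn_gt0 n0); rewrite dvdn_divisors.
apply: bigcup_finite => [|A /= [x [_ _ cA]]]; first exact: fin.
by apply/finite_setP; exists d.
Qed.

(** The fixed points of iterates and products are explicit sets, unlike their closed orbits, so
    finiteness is transferred through them. A closed orbit of length n is the orbit of a point fixed
    by T^n. *)
Lemma finite_orbitsP : finite_orbits T <->
  forall n, 0 < n -> finite_set (fixed_points n).
Proof.
split=> [fin n|fin n n0]; first exact: finite_fixed_points.
apply: sub_finite_set (finite_image orbit_of (fin n n0)) => A /= oA.
have [x [xn AE _]] := oA.
by exists x => //; have [//|-> //] := @closed_orbit_orbit n A x oA _; rewrite AE; exists 0.
Qed.

End PeriodicPoints.

(** Double counting of the triples (x, d, A) where d divides n and the point x, fixed by T^n, lies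
    in the closed orbit A of length d: each x occurs with a single d and a single A, and each A
    contributes its d points. *)
Lemma card_fixed_points_choice (X : choiceType) (T : X -> X) n :
  finite_orbits T -> (0 < n)%N ->
  #|` fset_set (fixed_points T n)|%fset = fix_count T n.
Proof.
move=> fin n0; have finF := finite_fixed_points fin n0.
rewrite /fix_count.
pose S d := fset_set [set A | closed_orbit T d A].
transitivity (\sum_(x <- fset_set (fixed_points T n)) \sum_(d <- divisors n)
   \sum_(A <- S d) (x \in A))%N.
  rewrite -sum1_size big_seq [RHS]big_seq; apply: eq_bigr => x.
  rewrite in_fset_set// => /set_mem xn; have [d dn od] := orbit_closed n0 xn.
  have d0 : (0 < d)%N by apply: dvdn_gt0 dn.
  rewrite (bigD1_seq d) ?divisors_uniq -?dvdn_divisors//= [X in (_ + X)%N]big1_seq ?addn0.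
    rewrite (bigD1_seq (orbit_of T x)) ?fset_uniq//=; last first.
      by rewrite in_fset_set; [exact/mem_set|exact: fin].
    rewrite [X in (_ + X)%N]big1_seq ?addn0; first by rewrite mem_set//; exists 0.
    move=> A /andP[nA]; rewrite in_fset_set; last exact: fin.
    move=> /set_mem oA; case: (boolP (x \in A)) => // /set_mem xA.
    by case/negP: nA; apply/eqP; have [] := closed_orbit_orbit oA xA.
  move=> e /andP[ne]; rewrite -dvdn_divisors// => en.
  apply: big1_seq => A /andP[_].
  rewrite in_fset_set; last by apply: fin; apply: dvdn_gt0 en.
  move=> /set_mem oA; case: (boolP (x \in A)) => // /set_mem xA.
  have [AE _] := closed_orbit_orbit oA xA.
  case/negP: ne; apply/eqP.
  case: oA od => y [_ _ cA] [z [_ _ cB]]; rewrite AE in cA.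
  by apply/card_eq_II; apply: card_eq_trans cB; rewrite card_eq_sym.
rewrite exchange_big big_seq [RHS]big_seq; apply: eq_bigr => d /=.
rewrite -dvdn_divisors// => dn; have d0 := dvdn_gt0 n0 dn.
rewrite exchange_big /= mulnC /orbit_count -/(S d).
transitivity (\sum_(A <- S d) d)%N; last first.
  by rewrite big_const_seq count_predT iter_addn_0 mulnC.
rewrite big_seq [RHS]big_seq; apply: eq_bigr => A.
rewrite in_fset_set; last exact: fin.
move=> /set_mem oA; case: (oA) => _ [_ _ cA].
have finA : finite_set A by apply/finite_setP; exists d.
transitivity (count (fun x => x \in A) (fset_set (fixed_points T n))).
  by rewrite -sum1_count [RHS]big_mkcond; apply: eq_bigr => x _; case: ifP.
rewrite -size_filter -(card_fset_set cA); apply: perm_size.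
apply: uniq_perm; rewrite ?filter_uniq// => x.
rewrite mem_filter !in_fset_set//; apply: andb_idr.
move=> /set_mem xA; apply/mem_set; apply: iter_fixed_dvd dn.
by have [] := closed_orbit_orbit oA xA.
Qed.

Lemma card_fixed_points (X : Type) (T : X -> X) n :
  finite_orbits T -> (0 < n)%N ->
  (fixed_points T n #= `I_(fix_count T n))%card.
Proof.
move=> fin n0; have finF := finite_fixed_points fin n0.
have /finite_setP[m cm] := finF.
(* [{classic X}] supplies the choice structure on which [fset_set] relies. *)
by rewrite -(@card_fixed_points_choice {classic X} T n fin n0) (@card_fset_set {classic X} _ _ cm).
Qed.

(** * Fixed points of iterates and products *)

Lemma fix_count_iter (X : Type) (T : X -> X) k n :
  finite_orbits T -> (0 < k)%N -> (0 < n)%N ->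
  fix_count (iter k T) n = fix_count T (k * n).
Proof.
move=> fin k0 n0.
have FE m : fixed_points (iter k T) m = fixed_points T (k * m).
  rewrite /fixed_points; under eq_set => x do rewrite -(iterM m k).
  by under [in RHS]eq_set => x do rewrite mulnC.
have fink : finite_orbits (iter k T).
  apply/finite_orbitsP => m m0; rewrite FE.
  by apply: finite_fixed_points; rewrite ?muln_gt0 ?k0.
apply/card_eq_II; apply: card_eq_trans (card_fixed_points fin _); last first.
  by rewrite muln_gt0 k0.
by rewrite card_eq_sym -FE; apply: card_fixed_points.
Qed.

Lemma card_fset_prod (X Y : choiceType) (A : {fset X}) (B : {fset Y}) :
  #|` (A `*` B)%fset|%fset = (#|` A|%fset * #|` B|%fset)%N.
Proof.
rewrite -(size_allpairs (@pair X Y)); apply: perm_size.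
apply: uniq_perm; rewrite ?fset_uniq ?allpairs_uniq ?fset_uniq//.
  by move=> [a b] [c d].
move=> [x y]; rewrite in_fsetM /=; apply/andP/allpairsP => [[xA yB]|].
  by exists (x, y).
by case=> -[a b] /= [aA bB [-> ->]].
Qed.

Lemma fix_count_prod (X Y : Type) (S : X -> X) (T : Y -> Y) n :
  finite_orbits S -> finite_orbits T -> (0 < n)%N ->
  fix_count (prod_map S T) n = (fix_count S n * fix_count T n)%N.
Proof.
move=> finS finT n0.
have iterE m x y : iter m (prod_map S T) (x, y) = (iter m S x, iter m T y).
  by elim: m => //= m ->.
have FE m : fixed_points (prod_map S T) m =
    fixed_points S m `*` fixed_points T m.
  apply/seteqP; split=> -[x y]; rewrite /fixed_points /= iterE.
    by case.
  by move=> [-> ->].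
have finST : finite_orbits (prod_map S T).
  by apply/finite_orbitsP => m m0; rewrite FE; apply: finite_setX;
    apply: finite_fixed_points.
have cS := card_fixed_points finS n0; have cT := card_fixed_points finT n0.
have cST := card_fixed_points finST n0; rewrite FE in cST.
rewrite -(@card_fset_set {classic X} _ _ cS) -(@card_fset_set {classic Y} _ _ cT).
rewrite -card_fset_prod -fset_setX; [|exact: finite_fixed_points..].
by rewrite -(@card_fset_set ({classic X} * {classic Y})%type _ _ cST).
Qed.

(** * Logarithmic derivatives of rational power series *)

Section TruncatedSeries.
Variable K : fieldType.
Implicit Types p q r : {poly K}.

(** Congruence modulo X^N: identities of power series are handled as congruences between
    truncations, for every N. *)
Definition eqX N p q := exists r, p = q + 'X^N * r.

Definition trunc N (u : nat -> K) : {poly K} := \poly_(i < N) u i.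

Lemma eqXP N p q : eqX N p q <-> forall i, (i < N)%N -> p`_i = q`_i.
Proof.
split=> [[r ->] i iN|H]; first by rewrite coefD coefXnM iN addr0.
exists (drop_poly N (p - q)); apply/polyP => i.
rewrite coefD coefXnM; case: ltnP => iN; first by rewrite addr0 H.
by rewrite coef_drop_poly subnK// coefB addrC subrK.
Qed.

Lemma coefXderiv p i : ('X * p^`())`_i = p`_i *+ i.
Proof. by rewrite coefXM coef_deriv; case: i. Qed.

Lemma eqX_Xderiv N p q : eqX N p q -> eqX N ('X * p^`()) ('X * q^`()).
Proof.
by move=> /eqXP pq; apply/eqXP => i iN; rewrite !coefXderiv pq.
Qed.

Lemma eqX_exp N p q j : eqX N p q -> eqX N (p ^+ j) (q ^+ j).
Proof.
move=> [r ->]; elim: j => [|j [s IH]]; first by exists 0; rewrite mulr0 addr0.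
exists (q * s + r * q ^+ j + 'X^N * r * s); rewrite !exprS IH; ring.
Qed.

Lemma coef_exp_lt p i j : p`_0 = 0 -> (i < j)%N -> (p ^+ j)`_i = 0.
Proof.
move=> p0 ij; have -> : p = 'X * drop_poly 1 p.
  by apply/polyP => -[|k]; rewrite coefXM// coef_drop_poly addn1.
by rewrite exprMn coefXnM ij.
Qed.

(** [fps_exp] truncates at an order that depends on the coefficient. Since X divides f, the powers
    f^j with j > i have no coefficient at X^i, so one common truncation serves all i < N. *)
Lemma trunc_fps_exp N (f : nat -> K) : f 0%N = 0 ->
  eqX N (trunc N (fps_exp f)) (\sum_(j < N) (j`!%:R)^-1 *: trunc N f ^+ j).
Proof.
move=> f0; apply/eqXP => i iN; rewrite coef_poly iN coef_sum /fps_exp.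
rewrite (big_ord_widen_cond N xpredT (fun j => ((\poly_(i0 < i.+1) f i0) ^+ j)`_i / j`!%:R))//.
rewrite big_mkcond; apply: eq_bigr => j _ /=; rewrite coefZ mulrC.
have [ji|ij] := ltnP j i.+1; last first.
  by rewrite coef_exp_lt ?mulr0// coef_poly f0 if_same.
congr (_ * _); have /eqXP -> // : eqX i.+1 (trunc i.+1 f ^+ j) (trunc N f ^+ j).
apply: eqX_exp; apply/eqXP => k ki; rewrite !coef_poly ki.
by rewrite (leq_trans ki iN).
Qed.

(** This is X (exp f)' = X f' exp f. Differentiating a truncated exponential loses only its last
    term p^N / N!, and X p^N vanishes modulo X^(N+1). *)
Lemma fps_exp_log_deriv N (f : nat -> K) :
    (forall n, (0 < n)%N -> n%:R != 0 :> K) -> f 0%N = 0 ->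
  eqX N ('X * (trunc N (fps_exp f))^`())
        (trunc N (fun n => f n *+ n) * trunc N (fps_exp f)).
Proof.
move=> char0 f0; have := trunc_fps_exp N f0; set e := trunc N (fps_exp f).
case: N @e => [|N] e; first by move=> _; apply/eqXP.
set p := trunc N.+1 f; set E := \sum_(j < N.+1) _ => eE.
have p0 : p`_0 = 0 by rewrite coef_poly /= f0.
have -> : trunc N.+1 (fun n => f n *+ n) = 'X * p^`().
  by apply/polyP => i; rewrite coefXderiv !coef_poly; case: ifP; rewrite ?mul0rn.
have dE : E^`() = p^`() * (E - (N`!%:R)^-1 *: p ^+ N).
  rewrite {2}/E big_ord_recr /= addrK /E raddf_sum /= big_ord_recl /=.
  rewrite derivZ expr0 derivC scaler0 add0r mulr_sumr; apply: eq_bigr => j _.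
  rewrite derivZ deriv_exp /bump /= add1n /= -scaler_nat scalerA -scalerAr.
  congr (_ *: _); rewrite factS natrM invfM mulrAC mulVf ?mul1r//.
  exact: char0.
have [r pr] : eqX N (p ^+ N) 0.
  by apply/eqXP => i iN; rewrite coef0 coef_exp_lt.
have [s Es] := eqX_Xderiv eE; have [t Et] := eE.
exists (s - p^`() * ((N`!%:R)^-1 *: r) - 'X * p^`() * t).
rewrite Es dE Et pr add0r; rewrite -!mul_polyC exprS; ring.
Qed.

(** The truncated expansion of X / (X - z), the contribution of one zero z to X P' / P. *)
Definition root_logderiv N (z : K) : {poly K} :=
  if z == 0 then 1 else trunc N (fun n => if n == 0%N then 0 else - z ^- n).

Lemma logderiv_factors N (rs : seq K) :
  let P := \prod_(z <- rs) ('X - z%:P) in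
  eqX N ('X * P^`()) (P * \sum_(z <- rs) root_logderiv N z).
Proof.
elim: rs => [|z rs IH] /=.
  by rewrite !big_nil derivC !mulr0; exists 0; rewrite mulr0 addr0.
rewrite !big_cons derivM derivXsubC mul1r.
set P := \prod_(_ <- _) _ in IH *; set G := \sum_(_ <- _) _ in IH *.
have [r Hr] : eqX N 'X (('X - z%:P) * root_logderiv N z).
  rewrite /root_logderiv; case: eqVneq => [->|z0].
    by exists 0; rewrite subr0 mulr1 mulr0 addr0.
  apply/eqXP => i iN; rewrite coefX mulrBl coefB coefXM coefCM !coef_poly iN.
  case: i iN => [|[|i]] iN /=; rewrite ?(ltnW iN) ?mulr0 ?subrr//.
    by rewrite expr1 mulrN opprK add0r divff.
  by rewrite mulrN opprK [z ^+ i.+2]exprS invfM mulrA divff// mul1r addNr.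
have [s Hs] := IH; exists (r * P + ('X - z%:P) * s).
have -> : 'X * (P + ('X - z%:P) * P^`()) = 'X * P + ('X - z%:P) * ('X * P^`()).
  by ring.
by rewrite {1}Hr Hs; ring.
Qed.

Lemma eqX_all_eq0 p : (forall N, eqX N p 0) -> p = 0.
Proof.
move=> H; apply/polyP => i.
by have /eqXP -> := H i.+1; rewrite ?coef0.
Qed.

(** A polynomial with nonzero constant term is a unit among power series; cancelling X^s costs s
    orders of precision. *)
Lemma eqX_mulI N s p q : q`_0 != 0 -> eqX N ('X^s * q * p) 0 -> eqX (N - s) p 0.
Proof.
move=> q0 /eqXP H; apply/eqXP => i; rewrite coef0.
have {}H j : (j < N - s)%N -> (q * p)`_j = 0.
  move=> jN; have := H (s + j)%N; rewrite -mulrA coefXnM ifN; last by rewrite -leqNgt leq_addr.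
  by rewrite addKn coef0; apply; rewrite -ltn_subRL.
elim/ltn_ind: i => i IH iN; have := H i iN.
rewrite coefM big_ord_recl /= subn0 big1 ?addr0.
  by move/eqP; rewrite mulf_eq0 (negbTE q0) => /eqP.
move=> j _; rewrite IH ?mulr0//; rewrite /bump /=; have := ltn_ord j; lia.
Qed.

End TruncatedSeries.

(** With exp f = P / Q, the logarithmic derivative gives X f' = X P' / P - X Q' / Q. A nonzero zero
    z contributes z^-n at X^n, with sign + for Q and - for P; a zero at 0 affects the constant term
    only. *)
Lemma rational_fps_exp_power_sums (K : closedFieldType) (f : nat -> K) :
    (forall n, (0 < n)%N -> n%:R != 0 :> K) -> f 0%N = 0 ->
    fps_rational (fps_exp f) ->
  exists s t : seq K, [/\ 0 \notin s, 0 \notin t & forall n, (0 < n)%N ->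
    f n *+ n = \sum_(a <- s) a ^+ n - \sum_(b <- t) b ^+ n].
Proof.
move=> char0 f0 [P [Q [Q0 QP]]].
have QZ N : eqX N (Q * trunc N (fps_exp f)) P.
  apply/eqXP => i iN; rewrite -QP coefM; apply: eq_bigr => j _.
  by rewrite coef_poly (leq_ltn_trans (leq_subr _ _) iN).
have e0 : fps_exp f 0%N = 1.
  by rewrite /fps_exp big_ord_recl big_ord0 /= expr0 coef1 fact0 divr1 addr0.
(* Otherwise Q exp f = 0, although exp f has constant term 1. *)
have P0 : P != 0.
  apply: contra_neq Q0 => P0; apply: eqX_all_eq0 => N; case: N => [|N].
    exact/eqXP.
  have := @eqX_mulI K N.+1 0 Q (trunc N.+1 (fps_exp f)).
  rewrite expr0 mul1r subn0; apply; first by rewrite coef_poly /= e0 oner_eq0.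
  by rewrite mulrC -P0; apply: QZ.
have [rP rPE] := closed_field_poly_normal P.
have [rQ rQE] := closed_field_poly_normal Q.
set cP := lead_coef P in rPE; set cQ := lead_coef Q in rQE.
have cP0 : cP != 0 by rewrite lead_coef_eq0.
have cQ0 : cQ != 0 by rewrite lead_coef_eq0.
set P1 := \prod_(z <- rP) _ in rPE; set Q1 := \prod_(z <- rQ) _ in rQE.
pose g N rs := \sum_(z <- rs) @root_logderiv K N z.
(* The formula for X f' multiplied by P, which avoids division. *)
have key N : eqX N (P * (trunc N (fun n => f n *+ n) + g N rQ - g N rP)) 0.
  have [a Ha] := QZ N; have [b Hb] := eqX_Xderiv (QZ N).
  have [c Hc] := fps_exp_log_deriv N char0 f0.
  have [d Hd] := logderiv_factors N rP; have [e He] := logderiv_factors N rQ.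
  rewrite -/P1 -/Q1 -/(g N rP) -/(g N rQ) in Hd He.
  set Z := trunc N (fps_exp f) in Ha Hb Hc.
  set F := trunc N _ in Hc *.
  have HP : 'X * P^`() = P * g N rP + 'X^N * (cP%:P * d).
    by rewrite rPE -!mul_polyC derivM derivC mul0r add0r; ring: Hd.
  have HQ : 'X * Q^`() = Q * g N rQ + 'X^N * (cQ%:P * e).
    by rewrite rQE -!mul_polyC derivM derivC mul0r add0r; ring: He.
  exists (cP%:P * d + b - cQ%:P * e * Z - Q * c - a * (F + g N rQ)).
  have E : 'X * Q^`() * Z + Q * ('X * Z^`()) = 'X * P^`() + 'X^N * b.
    by rewrite -Hb derivM; ring.
  rewrite HP HQ Hc in E; rewrite add0r; apply/eqP; rewrite -subr_eq0; apply/eqP.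
  move/eqP: E; rewrite -subr_eq0 => /eqP E; move/eqP: Ha; rewrite -subr_eq0 => /eqP Ha.
  (* The claim is the product rule [E] minus [F + g N rQ] times [Ha], both now in the form
     [_ = 0]. *)
  transitivity (0 - 0 * (F + g N rQ)); last by rewrite mul0r subr0.
  by rewrite -{1}E -Ha; ring.
have [m [P2]] := multiplicity_XsubC P 0; rewrite P0 subr0 /= => P20 PE.
exists [seq z^-1 | z <- rQ & z != 0], [seq z^-1 | z <- rP & z != 0].
have n0 (l : seq K) : 0 \notin [seq z^-1 | z <- l & z != 0].
  apply/mapP => -[z]; rewrite mem_filter => /andP[z0 _] /esym/eqP.
  by rewrite invr_eq0 (negbTE z0).
split=> // n n_gt0.
have gE N rs : (n < N)%N ->
    (g N rs)`_n = - \sum_(a <- [seq z^-1 | z <- rs & z != 0]) a ^+ n.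
  move=> nN; rewrite /g coef_sum big_map big_filter -sumrN [RHS]big_mkcond.
  apply: eq_bigr => z _; rewrite /root_logderiv; case: eqVneq => [_|z0] /=.
    by rewrite coef1 gtn_eqF.
  by rewrite coef_poly nN gtn_eqF// exprVn.
(* Cancelling the factor X^m of P leaves precision n + 1, enough to read the coefficient of X^n. *)
set N := (m + n.+1)%N; have nN : (n < N)%N by rewrite /N addnS ltnS leq_addl.
have P2c : P2`_0 != 0 by rewrite -horner_coef0.
have := key N; rewrite {1}PE [P2 * _]mulrC => /(eqX_mulI P2c).
rewrite /N addKn -/N => /eqXP/(_ n (ltnSn n)).
rewrite coef0 coefB coefD coef_poly nN !gE//; set A := \sum_(_ <- _) _.
set B := \sum_(_ <- _) _; move/eqP; rewrite subr_eq0 subr_eq => /eqP ->.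
by rewrite addrC.
Qed.

(** * Unique products and exponential sums *)

Section UniqueProducts.
Variable K : fieldType.

Definition torsion (x : K) := exists2 m, (0 < m)%N & x ^+ m = 1.

(** The non-degeneracy condition, read as having distinct classes in the multiplicative group of K
    modulo its torsion. *)
Definition torsion_independent (S : seq K) :=
  0 \notin S /\ {in S &, forall a b, a != b -> ~ torsion (a / b)}.

(** The positive elements of a partial order on the nonzero elements, where a is above b when a / b
    lies in P. *)
Definition is_cone (P : set K) := [/\ ~ P 0,
  forall x y, P x -> P y -> P (x * y) & forall x, P x -> ~ torsion x].

(** The multiplicative semigroup generated by P and x. *)
Definition cone_adjoin (P : set K) x : set K :=
  [set y | P y \/ exists2 k, (0 < k)%N & y = x ^+ k \/ exists2 p, P p & y = p * x ^+ k].

Lemma cone_exp (P : set K) x k : is_cone P -> (0 < k)%N -> P x -> P (x ^+ k).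
Proof.
move=> [_ PM _]; case: k => // k _ Px; elim: k => // k IH.
by rewrite exprS; apply: PM.
Qed.

(** The only serious obstruction is a torsion element p x^k: if (p x^k)^m = 1, then x^(-km) = p^m
    lies in P. *)
Lemma cone_adjoin_or (P : set K) x : is_cone P -> x != 0 -> ~ torsion x ->
  is_cone (cone_adjoin P x) \/ exists2 k, (0 < k)%N & P (x ^- k).
Proof.
move=> coneP x0 tx; have [P0 PM Pt] := coneP.
have [?|nk] := pselect (exists2 k, (0 < k)%N & P (x ^- k)); [by right|left].
split.
- case=> [//|[k k0 []]].
    by move/esym/eqP; rewrite expf_eq0 (negbTE x0) andbF.
  case=> p Pp /esym/eqP; rewrite mulf_eq0 expf_eq0 (negbTE x0) andbF orbF.
  by move/eqP => p0; apply: P0; rewrite -p0.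
- move=> y z; case=> [Py|[k k0 Hy]] [Pz|[l l0 Hz]].
  + by left; apply: PM.
  + right; exists l => //; right; case: Hz => [->|[p Pp ->]].
      by exists y.
    by exists (y * p); [apply: PM|rewrite mulrA].
  + right; exists k => //; right; case: Hy => [->|[p Pp ->]].
      by exists z; rewrite // mulrC.
    by exists (p * z); [apply: PM|rewrite mulrAC].
  + right; exists (k + l)%N; rewrite ?addn_gt0 ?k0// exprD.
    case: Hy => [->|[p Pp ->]]; case: Hz => [->|[q Pq ->]].
    * by left.
    * by right; exists q => //; rewrite mulrCA.
    * by right; exists p => //; rewrite mulrA.
    * by right; exists (p * q); [apply: PM|rewrite mulrACA].
- move=> y; case=> [/Pt//|[k k0 [->|[p Pp ->]]]] [m m0 e]; first apply: tx.
    by exists (k * m)%N; rewrite ?muln_gt0 ?k0// exprM.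
  apply: nk; exists (k * m)%N; first by rewrite muln_gt0 k0.
  suff -> : x ^- (k * m) = p ^+ m by apply: cone_exp.
  by rewrite -[LHS]mul1r -e exprMn -exprM mulfK// expf_neq0.
Qed.

(** Orderability of torsion-free abelian groups: a cone that is maximal by Zorn's lemma is total
    modulo torsion. *)
Lemma total_cone :
  exists P, is_cone P /\ forall x, x != 0 -> ~ torsion x -> P x \/ P x^-1.
Proof.
have [F Fc Ft|P [coneP Pmax]] := @Zorn_bigcup K is_cone.
  split=> [[P FP P0]|x y [P FP Px] [Q FQ Qy]|x [P FP]].
  - by have [] := Fc _ FP.
  - have [PQ|QP] := Ft _ _ FP FQ.
      by exists Q => //; have [_ M _] := Fc _ FQ; apply: M => //; apply: PQ.
    by exists P => //; have [_ M _] := Fc _ FP; apply: M => //; apply: QP.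
  - by have [_ _ ] := Fc _ FP; apply.
exists P; split=> // x x0 tx; have [P0 PM Pt] := coneP.
have step y : y != 0 -> ~ torsion y -> ~ P y ->
    exists2 k, (0 < k)%N & P (y ^- k).
  move=> y0 ty Py; have [cone'|//] := cone_adjoin_or coneP y0 ty.
  case: (Pmax (cone_adjoin P y)) => //; split; first by move=> z Pz; left.
  by move=> /(_ y) Py'; apply/Py/Py'; right; exists 1%N => //; left; rewrite expr1.
have [Px|nPx] := pselect (P x); [by left|right].
have [//|nPx'] := pselect (P x^-1).
have [k k0 Pk] := step x x0 tx nPx.
have [||//|l l0] := step x^-1; rewrite ?invr_eq0//.
  by case=> m m0; rewrite exprVn => /eqP; rewrite invr_eq1 => /eqP e; apply: tx; exists m.
(* Both x^-k and x^l lie in P, hence so does 1 = (x^-k)^l (x^l)^k, which is torsion. *)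
rewrite exprVn invrK => Pl; exfalso; apply: (Pt 1); last by exists 1%N; rewrite ?expr1.
have := PM _ _ (cone_exp coneP l0 Pk) (cone_exp coneP k0 Pl).
by rewrite -exprVn -!exprM exprVn [(l * k)%N]mulnC mulVf// expf_neq0.
Qed.

Lemma cone_max P (S : seq K) : is_cone P ->
    (forall x, x != 0 -> ~ torsion x -> P x \/ P x^-1) ->
    S != [::] -> torsion_independent S ->
  exists2 a, a \in S & {in S, forall b, b != a -> P (a / b)}.
Proof.
move=> coneP tot; elim: S => // x S IH _ [S0 tS].
have [->|Sn] := eqVneq S [::].
  by exists x; rewrite ?mem_head// => b; rewrite inE => ->.
have [a aS amax] : exists2 a, a \in S & {in S, forall b, b != a -> P (a / b)}.
  apply: IH => //; split; first by apply: contra S0; rewrite inE => ->; rewrite orbT.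
  by move=> b c bS cS; apply: tS; rewrite inE ?bS ?cS orbT.
have nz y : y \in x :: S -> y != 0 by apply: contraTneq => ->.
have aS' : a \in x :: S by rewrite inE aS orbT.
have [xa|xa] := eqVneq x a.
  exists a => // b; rewrite inE => /orP[/eqP ->|]; last exact: amax.
  by rewrite xa eqxx.
have a0 := nz a aS'; have x0 := nz x (mem_head _ _).
have [||Pxa|] := tot (x / a).
- by rewrite mulf_neq0// invr_eq0.
- by apply: tS => //; rewrite mem_head.
- exists x; first exact: mem_head.
  move=> b; rewrite inE => /orP[/eqP ->|bS bx]; first by rewrite eqxx.
  have [->//|ba] := eqVneq b a.
  have [_ PM _] := coneP; have := PM _ _ Pxa (amax b bS ba).
  by rewrite mulrA divfK.
- rewrite invf_div => Pax; exists a => // b.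
  by rewrite inE => /orP[/eqP ->//|]; apply: amax.
Qed.

(* The quotient of the group by its torsion is orderable, and the product of the
   two maxima is attained only once. *)
Lemma unique_product (S T : seq K) : S != [::] -> T != [::] ->
    torsion_independent S -> torsion_independent T ->
  exists2 a, a \in S & exists2 b, b \in T &
    forall a' b', a' \in S -> b' \in T -> a' * b' = a * b -> a' = a /\ b' = b.
Proof.
move=> S0 T0 tS tT; have [P [coneP tot]] := total_cone.
have [a aS amax] := cone_max coneP tot S0 tS.
have [b bT bmax] := cone_max coneP tot T0 tT.
exists a => //; exists b => // a' b' a'S b'T e.
have nz U y : torsion_independent U -> y \in U -> y != 0.
  by move=> [U0 _]; apply: contraTneq => ->.
have a0 := nz _ _ tS aS; have b0 := nz _ _ tT bT.
have a'0 := nz _ _ tS a'S; have b'0 := nz _ _ tT b'T.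
have [aa|aa] := eqVneq a' a.
  by split=> //; apply: (mulfI a0); rewrite -{1}aa.
have [bb|bb] := eqVneq b' b.
  by case/eqP: aa; apply: (mulIf b0); rewrite -e bb.
have [_ PM Pt] := coneP; have := PM _ _ (amax _ a'S aa) (bmax _ b'T bb).
rewrite mulf_div -e divff ?mulf_neq0// => /Pt; case.
by exists 1%N; rewrite ?expr1.
Qed.

End UniqueProducts.

(** * Isolating one frequency of an exponential sum *)

Section ExponentialSums.
Variables (K : fieldType) (J : eqType).
Implicit Types (I : seq J) (c nu : J -> K) (p : {poly K}).

(** The polynomial p in the shift operator acts on the sequence nu^n as multiplication by p(nu). *)
Lemma poly_shift_exp_sum I c nu p n :
  \sum_(j < size p) p`_j * (\sum_(i <- I) c i * nu i ^+ (n + j)) =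
  \sum_(i <- I) c i * p.[nu i] * nu i ^+ n.
Proof.
under eq_bigr do rewrite mulr_sumr.
rewrite exchange_big; apply: eq_bigr => i _ /=.
rewrite horner_coef mulr_sumr mulr_suml; apply: eq_bigr => j _.
by rewrite exprD; ring.
Qed.

(** Indices in [J] are kept apart from frequencies, so that indices other than [i0] may share a
    frequency, as pairs do in the product case. *)
Definition isolating_poly I nu i0 : {poly K} :=
  \prod_(i <- I | i != i0) ('X - (nu i)%:P).

Lemma isolating_poly_neq0 I nu i0 :
  {in I, forall i, i != i0 -> nu i != nu i0} ->
  (isolating_poly I nu i0).[nu i0] != 0.
Proof.
move=> H; rewrite horner_prod big_seq_cond prodf_seq_neq0.
apply/allP => i _; apply/implyP => /andP[iI ii0].
by rewrite hornerXsubC subr_eq0 eq_sym H.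
Qed.

Lemma isolate_exp_sum I c nu i0 n : uniq I -> i0 \in I ->
  let p := isolating_poly I nu i0 in
  \sum_(j < size p) p`_j * (\sum_(i <- I) c i * nu i ^+ (n + j)) =
  c i0 * p.[nu i0] * nu i0 ^+ n.
Proof.
move=> uI i0I p; rewrite poly_shift_exp_sum (bigD1_seq i0)//= [X in _ + X]big_seq_cond.
rewrite big1 ?addr0// => i /andP[iI ii0].
suff /rootP -> : root p (nu i) by rewrite mulr0 mul0r.
rewrite /root horner_prod prodf_seq_eq0; apply/hasP; exists i => //.
by rewrite ii0 hornerXsubC subrr eqxx.
Qed.

End ExponentialSums.

(** If all terms in a window of [size p] consecutive indices were small, so would be their
    combination with the coefficients of the isolating polynomial, which is a nonzero multiple of
    nu(i0)^n. *)
Lemma exp_sum_lower_bound (K : numFieldType) (J : eqType) (I : seq J)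
    (c nu : J -> K) i0 :
    uniq I -> i0 \in I -> {in I, forall i, i != i0 -> nu i != nu i0} ->
    c i0 != 0 -> nu i0 != 0 ->
  exists e, 0 < e /\ exists N, forall n, exists2 j, (j < N)%N &
    e * `|nu i0| ^+ (n + j) <= `|\sum_(i <- I) c i * nu i ^+ (n + j)|.
Proof.
move=> uI i0I iso c0 nu0; pose p := isolating_poly I nu i0.
pose D := `|c i0 * p.[nu i0]|.
have D0 : 0 < D by rewrite normr_gt0 mulf_neq0// isolating_poly_neq0.
pose S := \sum_(j < size p) `|p`_j| * `|nu i0| ^+ j.
have S0 : 0 <= S by apply: sumr_ge0 => j _; rewrite mulr_ge0// exprn_ge0.
have S1 : 0 < S + 1 by rewrite ltr_wpDl.
(* Small terms would bound D by D S / (S + 1), which is less than D. *)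
exists (D / (S + 1)); split; first exact: divr_gt0.
exists (size p) => n.
have [/existsP[j Hj]|] := boolP [exists j : 'I_(size p),
    D / (S + 1) * `|nu i0| ^+ (n + j) <= `|\sum_(i <- I) c i * nu i ^+ (n + j)|].
  by exists j.
rewrite negb_exists => /forallP small; exfalso.
have : D * `|nu i0| ^+ n <= D / (S + 1) * S * `|nu i0| ^+ n.
  rewrite -normrX {1}/D -normrM -isolate_exp_sum// -/p.
  apply: le_trans (ler_norm_sum _ _ _) _.
  rewrite /S mulr_sumr mulr_suml; apply: ler_sum => j _.
  rewrite normrM normrX [leRHS](_ : _ =
    `|p`_j| * (D / (S + 1) * `|nu i0| ^+ (n + j))); last by rewrite exprD; ring.
  apply: ler_wpM2l => //; apply: ltW.
  rewrite real_ltNge ?small ?normr_real//.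
  by rewrite realM ?realX ?normr_real// gtr0_real// divr_gt0.
rewrite ler_pM2r ?exprn_gt0 ?normr_gt0// -mulrA ler_pMr//.
by rewrite mulrC ler_pdivlMr// mul1r gerDl ler10.
Qed.

(** Applying p to the shift turns each coefficient c(b) into c(b) p(b), and the resulting sum
    vanishes. Isolating a then forces p(a) = 0. *)
Lemma root_of_recurrence (K : numFieldType) (S : seq K) (c : K -> K) u p :
    uniq S -> 0 \notin S -> {in S, forall a, c a != 0} ->
    (forall n, (0 < n)%N -> u n = \sum_(a <- S) c a * a ^+ n) ->
    satisfies_recurrence u p -> {in S, forall a, root p a}.
Proof.
move=> uS S0 c0 uE rec a aS; pose q := isolating_poly S id a.
have p0 n : (0 < n)%N -> \sum_(b <- S) c b * p.[b] * b ^+ n = 0.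
  move=> n0; rewrite -(@poly_shift_exp_sum _ _ S c id).
  by rewrite -[RHS](rec n n0); apply: eq_bigr => j _; rewrite uE// addn_gt0 n0.
(* The exponent is 1 because the recurrence is known for positive indices only. *)
have := @isolate_exp_sum _ _ S (fun b => c b * p.[b]) id a 1 uS aS.
rewrite /= big1 => [|j _]; last by rewrite p0 ?mulr0.
have a0 : a != 0 by apply: contraNneq S0 => <-.
have q0 : q.[a] != 0 by apply: (@isolating_poly_neq0 _ _ S id) => b.
move/esym/eqP; rewrite expr1 !mulf_eq0 (negbTE (c0 _ aS)) (negbTE a0).
by rewrite (negbTE q0) !orbF.
Qed.

(** * Growth of exponential sums *)

Definition root_limsup (R : realType) (u : nat -> R) : \bar R :=
  limn_esup (fun n => (u n `^ n%:R^-1)%:E).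

Section RootLimsup.
Variable R : realType.

Lemma cvg_nat_root (c : R) : 0 < c ->
  (fun n => c `^ n%:R^-1) @ \oo --> (1 : R).
Proof.
move=> c0; rewrite -(cvg_shiftS (fun n => c `^ n%:R^-1)) /=.
have -> : (fun n => c `^ n.+1%:R^-1) = (fun n => expR (n.+1%:R^-1 * ln c)).
  by apply/funext => n; rewrite /powR gt_eqF.
have cvg0 : (fun n => n.+1%:R^-1 * ln c) @ \oo --> 0 * ln c.
  by apply: cvgMr_tmp; exact: cvg_harmonic.
have := continuous_cvg _ (@continuous_expR R _) cvg0.
by rewrite mul0r expR0; apply.
Qed.

(** The supremum of the roots over m >= n is squeezed between e'^(1/n) L and C'^(1/n) L. *)
Lemma root_limsup_eq (u : nat -> R) (C e L : R) : 0 < C -> 0 < e -> 0 < L ->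
    (forall n, 0 <= u n) -> (forall n, (0 < n)%N -> u n <= C * L ^+ n) ->
    (forall n, exists2 m, (n <= m)%N & e * L ^+ m <= u m) ->
  root_limsup u = L%:E.
Proof.
move=> C0 e0 L0 u0 uC ue; rewrite /root_limsup limn_esup_lim.
(* With C' >= 1 and e' <= 1, the bounds C'^(1/m) and e'^(1/m) for m >= n are no worse than those at
   n. *)
pose C' := Num.max C 1; pose e' := Num.min e 1.
have C'1 : 1 <= C' by rewrite le_max lexx orbT.
have e'1 : 0 < e' <= 1 by rewrite lt_min e0 ltr01 ge_min lexx orbT.
have C'0 := lt_le_trans ltr01 C'1; have e'0 := proj1 (andP e'1).
have cvgL (c : R) : 0 < c -> (fun n => (c `^ n%:R^-1 * L)%:E) @ \oo --> L%:E.
  move=> c0; apply: cvg_EFin; first exact: nearW.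
  by rewrite -[X in _ --> X]mul1r; apply: cvgMr_tmp; exact: cvg_nat_root.
have rootE (c : R) m : 0 <= c -> (0 < m)%N ->
    (c * L ^+ m) `^ m%:R^-1 = c `^ m%:R^-1 * L.
  move=> c0 m0; rewrite powRM ?exprn_ge0 ?(ltW L0)//; congr (_ * _).
  by rewrite -powR_mulrn ?ltW// -powRrM divff ?pnatr_eq0 -?lt0n// powRr1 ?ltW.
have root_mono m x y : 0 <= x -> x <= y -> x `^ m%:R^-1 <= y `^ m%:R^-1.
  by move=> x0 xy; apply: ge0_ler_powR; rewrite ?nnegrE ?invr_ge0// (le_trans x0).
have invm n m : (0 < n)%N -> (n <= m)%N -> m%:R^-1 <= n%:R^-1 :> R.
  by move=> n0 nm; rewrite lef_pV2 ?posrE ?ltr0n ?ler_nat// (leq_trans n0).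
apply/cvg_lim => //; apply: squeeze_cvge (cvgL _ e'0) (cvgL _ C'0).
near=> n; have n0 : (0 < n)%N by near: n; exists 1%N.
apply/andP; split; last first.
  apply: ge_ereal_sup => _ [m /= nm <-]; have m0 := leq_trans n0 nm.
  rewrite lee_fin; apply: (@le_trans _ _ (C' `^ m%:R^-1 * L)).
    rewrite -rootE ?(ltW C'0)//; apply: root_mono => //.
    apply: le_trans (uC _ m0) _; rewrite ler_pM2r ?exprn_gt0//.
    by rewrite le_max lexx.
  by rewrite ler_pM2r//; apply: ler_powR => //; apply: invm.
have [m nm em] := ue n; have m0 := leq_trans n0 nm.
apply: (@le_trans _ _ (u m `^ m%:R^-1)%:E); last first.
  by apply: ereal_sup_ubound; exists m.
rewrite lee_fin; apply: (@le_trans _ _ (e' `^ m%:R^-1 * L)).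
  by rewrite ler_pM2r//; apply: ger_powR => //; apply: invm.
rewrite -rootE ?(ltW e'0)//; apply: root_mono.
  by rewrite mulr_ge0 ?exprn_ge0 ?ltW.
by apply: le_trans em; rewrite ler_pM2r ?exprn_gt0// ge_min lexx.
Unshelve. all: by end_near.
Qed.

Lemma root_limsup_eq0 (u : nat -> R) : (forall n, (0 < n)%N -> u n = 0) ->
  root_limsup u = 0%E.
Proof.
move=> u0; rewrite /root_limsup.
have cvg0 : (fun n => (u n `^ n%:R^-1)%:E) @ \oo --> 0%E.
  apply: cvg_near_cst; exists 1%N => // n /= n0.
  by rewrite u0// powR0// invr_eq0 pnatr_eq0 -lt0n.
by have [_ ->] := cvg_limn_einf_sup cvg0.
Qed.

(** The norm of [R[i]] takes its values in [R[i]]; this is the modulus as an element of [R]. *)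
Definition cabs (z : R[i]) : R := complex.Re `|z|.

Lemma cabsE (z : R[i]) : (cabs z)%:C%C = `|z|.
Proof. by rewrite /cabs normc_def. Qed.

(** The triangle inequality bounds the growth from above and isolation of [i0] from below. Other
    frequencies may have the same modulus and may coincide with each other, as long as they differ
    from that of [i0]. *)
Lemma root_limsup_exp_sum (J : eqType) (I : seq J) (c nu : J -> R[i]) i0
    (u : nat -> nat) :
    uniq I -> i0 \in I -> {in I, forall i, i != i0 -> nu i != nu i0} ->
    {in I, forall i, `|nu i| <= `|nu i0|} -> c i0 != 0 -> nu i0 != 0 ->
    (forall n, (0 < n)%N -> (u n)%:R = \sum_(i <- I) c i * nu i ^+ n) ->
  root_limsup (fun n => (u n)%:R) = (cabs (nu i0))%:E.
Proof.
move=> uI i0I iso numax c0 nu0 uE; set L := cabs _.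
have LE : L%:C%C = `|nu i0| by apply: cabsE.
have L0 : 0 < L by rewrite -ltcR LE normr_gt0.
have LXE n : `|nu i0| ^+ n = (L ^+ n)%:C%C by rewrite -LE rmorphXn.
have [e [e0 [N low]]] := exp_sum_lower_bound uI i0I iso c0 nu0.
have eE : (cabs e)%:C%C = e by rewrite cabsE gtr0_norm.
have uN n : (u n)%:R%:C%C = `|(u n)%:R| :> R[i] by rewrite rmorph_nat ger0_norm.
pose B := \sum_(i <- I) `|c i|.
have B0 : 0 < B.
  rewrite /B (bigD1_seq i0)//= ltr_wpDr ?normr_gt0//.
  by apply: sumr_ge0.
apply: (@root_limsup_eq _ (cabs B) (cabs e)) => //.
- by rewrite -ltcR cabsE gtr0_norm.
- by rewrite -ltcR eE.
- move=> n n0; rewrite -lecR uN uE// rmorphM /= -LXE cabsE (gtr0_norm B0).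
  apply: le_trans (ler_norm_sum _ _ _) _; rewrite /B mulr_suml.
  rewrite big_seq [leRHS]big_seq; apply: ler_sum => i iI.
  rewrite normrM normrX ler_wpM2l//; apply: lerXn2r; rewrite ?nnegrE//.
  exact: numax.
(* Starting the window at n + 1 gives a positive index beyond n, where [uE] applies. *)
move=> n; have [j _ Hj] := low n.+1; exists (n.+1 + j)%N.
  by rewrite (leq_trans (leqnSn n))// leq_addr.
by rewrite -lecR rmorphM /= eE -LXE uN uE.
Qed.

End RootLimsup.

(** * Radius of convergence *)

Lemma sum_seq_count (K : pzRingType) (s U : seq K) (f : K -> K) :
  uniq U -> {subset s <= U} ->
  \sum_(a <- s) f a = \sum_(a <- U) (count_mem a s)%:R * f a.
Proof.
move=> uU sU; transitivity (\sum_(a <- s) \sum_(b <- U) (a == b)%:R * f b).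
  rewrite big_seq [RHS]big_seq; apply: eq_bigr => a /sU aU.
  rewrite (bigD1_seq a)//= eqxx mul1r big1 ?addr0// => b ba.
  by rewrite eq_sym (negbTE ba) mul0r.
rewrite exchange_big; apply: eq_bigr => b _ /=.
by rewrite -mulr_suml -sum1_count natr_sum [in RHS]big_mkcond; congr (_ * _);
  apply: eq_bigr => a _ /=; case: eqP.
Qed.

(** Multiplicities are collected into coefficients, and frequencies that cancel are dropped. *)
Lemma power_sums_diff (K : fieldType) (s t : seq K) : 0 \notin s -> 0 \notin t ->
  exists S (c : K -> K), [/\ uniq S, 0 \notin S, {in S, forall a, c a != 0} &
    forall n, \sum_(a <- s) a ^+ n - \sum_(b <- t) b ^+ n =
              \sum_(a <- S) c a * a ^+ n].
Proof.
move=> s0 t0; pose U := undup (s ++ t).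
pose c a : K := (count_mem a s)%:R - (count_mem a t)%:R.
exists [seq a <- U | c a != 0], c; split=> [|||n].
- by rewrite filter_uniq// undup_uniq.
- by rewrite mem_filter mem_undup mem_cat negb_and negb_or s0 t0 orbT.
- by move=> a; rewrite mem_filter => /andP[].
have uU : uniq U by apply: undup_uniq.
have sU : {subset s <= U} by move=> a aS; rewrite mem_undup mem_cat aS.
have tU : {subset t <= U} by move=> a aS; rewrite mem_undup mem_cat aS orbT.
rewrite (sum_seq_count _ uU sU) (sum_seq_count _ uU tU) -sumrB.
rewrite big_filter [RHS]big_mkcond; apply: eq_bigr => a _.
by rewrite -mulrBl -/(c a); case: eqVneq => [->|//]; rewrite mul0r.
Qed.

(** Frequencies with nonzero coefficient are zeros of the minimal characteristic polynomial, so
    non-degeneracy applies to them. *)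
Lemma nondegenerate_power_sum (R : realType) (X : Type) (T : X -> X) :
  nondegenerate_rational_zeta R T ->
  exists (S : seq R[i]) (c : R[i] -> R[i]),
    [/\ uniq S, torsion_independent S, {in S, forall a, c a != 0} &
    forall n, (0 < n)%N -> (fix_count T n)%:R = \sum_(a <- S) c a * a ^+ n].
Proof.
move=> [rat [p [[_ rec _] nd]]].
have char0 n : (0 < n)%N -> n%:R != 0 :> R[i] by rewrite pnatr_eq0 lt0n.
have [|s [t [s0 t0 E]]] := rational_fps_exp_power_sums char0 _ rat.
  by rewrite invr0 mulr0.
have [S [c [uS S0 c0 SE]]] := power_sums_diff s0 t0.
have uE n : (0 < n)%N -> (fix_count T n)%:R = \sum_(a <- S) c a * a ^+ n.
  by move=> n0; rewrite -SE -E// -[RHS]mulr_natr divfK// char0.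
exists S, c; split=> //; split=> // a b aS bS ab [m m0 /eqP].
apply/negP; apply: nd => //.
  exact: (root_of_recurrence uS S0 c0 uE rec).
exact: (root_of_recurrence uS S0 c0 uE rec).
Qed.

Lemma max_norm (K : numDomainType) (S : seq K) : S != [::] ->
  exists2 a, a \in S & {in S, forall b, `|b| <= `|a|}.
Proof.
elim: S => // x S IH _; have [->|/IH[a aS amax]] := eqVneq S [::].
  by exists x; rewrite ?mem_head// => b; rewrite inE => /eqP ->.
have [xa|ax] := real_leP (normr_real x) (normr_real a).
  exists a; first by rewrite inE aS orbT.
  by move=> b; rewrite inE => /orP[/eqP ->//|]; apply: amax.
exists x; first exact: mem_head.
move=> b; rewrite inE => /orP[/eqP ->//|/amax ba].
exact: le_trans ba (ltW ax).
Qed.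

(** * Growth rates for iterates and products *)

Section Radius.
Variable R : realType.

Lemma cabsM (a b : R[i]) : cabs (a * b) = cabs a * cabs b.
Proof. by apply: complexI; rewrite rmorphM /= !cabsE normrM. Qed.

Lemma cabsX (a : R[i]) n : cabs (a ^+ n) = cabs a ^+ n.
Proof. by apply: complexI; rewrite rmorphXn /= !cabsE normrX. Qed.

(** The frequencies a^k stay distinct: b^k = a^k would make b / a a root of unity. *)
Lemma root_limsup_iter (S : seq R[i]) (c : R[i] -> R[i]) (a : R[i]) (u : nat -> nat) k : (0 < k)%N ->
    uniq S -> torsion_independent S -> {in S, forall a, c a != 0} ->
    (forall n, (0 < n)%N -> (u n)%:R = \sum_(a <- S) c a * a ^+ n) ->
    a \in S -> {in S, forall b, `|b| <= `|a|} ->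
  root_limsup (fun n => (u (k * n)%N)%:R : R) = (cabs a ^+ k)%:E.
Proof.
move=> k0 uS [S0 tS] c0 uE aS amax.
have nz b : b \in S -> b != 0 by apply: contraTneq => ->.
rewrite -cabsX; apply: (@root_limsup_exp_sum _ _ S c (fun b => b ^+ k) a
  (fun n => u (k * n)%N)) => //.
- move=> b bS ba; apply/eqP => e; apply: (tS b a) => //.
  by exists k => //; rewrite expr_div_n e divff// expf_neq0// nz.
- by move=> b bS; rewrite !normrX; apply: lerXn2r; rewrite ?nnegrE// amax.
- exact: c0.
- by rewrite expf_neq0// nz.
- move=> n n0; rewrite uE ?muln_gt0 ?k0//.
  by apply: eq_bigr => b _; rewrite exprM.
Qed.

(** A unique product b1 b2 is chosen among the frequencies of maximal modulus; its coefficient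
    c1(b1) c2(b2) cannot cancel. *)
Lemma root_limsup_prod (S1 S2 : seq R[i]) (c1 c2 : R[i] -> R[i])
    (a1 a2 : R[i]) (u1 u2 : nat -> nat) :
    uniq S1 -> torsion_independent S1 -> {in S1, forall a, c1 a != 0} ->
    (forall n, (0 < n)%N -> (u1 n)%:R = \sum_(a <- S1) c1 a * a ^+ n) ->
    a1 \in S1 -> {in S1, forall b, `|b| <= `|a1|} ->
    uniq S2 -> torsion_independent S2 -> {in S2, forall a, c2 a != 0} ->
    (forall n, (0 < n)%N -> (u2 n)%:R = \sum_(a <- S2) c2 a * a ^+ n) ->
    a2 \in S2 -> {in S2, forall b, `|b| <= `|a2|} ->
  root_limsup (fun n => (u1 n * u2 n)%:R : R) = (cabs a1 * cabs a2)%:E.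
Proof.
move=> uS1 tS1 c10 uE1 a1S amax1 uS2 tS2 c20 uE2 a2S amax2.
have nz (S : seq R[i]) b : torsion_independent S -> b \in S -> b != 0.
  by move=> [S0 _]; apply: contraTneq => ->.
pose top (S : seq R[i]) (a : R[i]) := [seq b <- S | `|b| == `|a|].
have top_ind (S : seq R[i]) a : torsion_independent S -> torsion_independent (top S a).
  move=> [S0 tS]; split; first by rewrite mem_filter negb_and S0 orbT.
  by move=> b d; rewrite !mem_filter => /andP[_ ?] /andP[_ ?]; apply: tS.
have top_n0 (S : seq R[i]) a : a \in S -> top S a != [::].
  move=> aS; have : a \in top S a by rewrite mem_filter eqxx.
  by case: (top S a).
have [b1 b1T [b2 b2T uniq12]] := unique_product (top_n0 _ _ a1S) (top_n0 _ _ a2S)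
  (top_ind _ a1 tS1) (top_ind _ a2 tS2).
move: (b1T) (b2T); rewrite !mem_filter => /andP[/eqP n1 b1S] /andP[/eqP n2 b2S].
have -> : cabs a1 * cabs a2 = cabs (b1 * b2) by rewrite cabsM /cabs n1 n2.
have b10 := nz _ _ tS1 b1S; have b20 := nz _ _ tS2 b2S.
have pairI d1 d2 : (d1, d2) \in [seq (x, y) | x <- S1, y <- S2] ->
    d1 \in S1 /\ d2 \in S2.
  by move=> /allpairsP[[x y] /= [xS yS [-> ->]]].
pose c (d : R[i] * R[i]) := c1 d.1 * c2 d.2.
apply: (@root_limsup_exp_sum _ _ [seq (x, y) | x <- S1, y <- S2] c
  (fun d => d.1 * d.2) (b1, b2) (fun n => u1 n * u2 n)%N).
- by apply: allpairs_uniq => // -[x y] [z w].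
- exact: allpairs_f.
(* A pair with product b1 b2 attains the maximal modulus of the product, hence in both factors, so
   uniqueness applies to it. *)
- move=> [d1 d2] /pairI[d1S d2S] dd; apply/eqP => /= e.
  have d10 := nz _ _ tS1 d1S; have d20 := nz _ _ tS2 d2S.
  have ne : `|d1| * `|d2| = `|a1| * `|a2| by rewrite -normrM e normrM n1 n2.
  have m1 : `|d1| = `|a1|.
    apply/eqP; rewrite eq_le amax1//= -(@ler_pM2r _ `|a2|) ?normr_gt0 ?(nz _ _ tS2)//.
    by rewrite -ne ler_pM2l ?normr_gt0// amax2.
  have m2 : `|d2| = `|a2|.
    by move: ne; rewrite m1; apply: mulfI; rewrite normr_eq0 (nz _ _ tS1).
  have [||e1 e2] := uniq12 d1 d2 _ _ e; rewrite ?mem_filter ?m1 ?m2 ?eqxx//.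
  by move: dd; rewrite e1 e2 eqxx.
- move=> [d1 d2] /pairI[d1S d2S] /=; rewrite !normrM n1 n2.
  by apply: ler_pM; rewrite ?amax1 ?amax2.
- by rewrite mulf_neq0 ?c10 ?c20.
- by rewrite mulf_neq0.
- move=> n n0; rewrite natrM uE1// uE2// big_allpairs mulr_suml.
  apply: eq_bigr => x _; rewrite mulr_sumr; apply: eq_bigr => y _ /=.
  by rewrite exprMn /c /=; ring.
Qed.

(* The value at n = 0 does not matter, since x `^ 0^-1 = x `^ 0 = 1. *)
Lemma zeta_radiusE (X : Type) (T : X -> X) (u : nat -> nat) :
  (forall n, (0 < n)%N -> fix_count T n = u n) ->
  zeta_radius R T = ((root_limsup (fun n => (u n)%:R : R))^-1)%E.
Proof.
move=> TE; rewrite /zeta_radius /root_limsup; congr (limn_esup _)^-1%E.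
by apply/funext => -[|n]; rewrite ?invr0 ?powRr0// TE.
Qed.

End Radius.

Theorem theorem2p4 (R : realType) (X1 X2 : Type)
    (T1 : X1 -> X1) (T2 : X2 -> X2)
    (fin1 : finite_orbits T1) (fin2 : finite_orbits T2)
    (nd1 : nondegenerate_rational_zeta R T1)
    (nd2 : nondegenerate_rational_zeta R T2) :
  (forall k : nat, (1 <= k)%N ->
     zeta_radius R (iter k T1) = (zeta_radius R T1 ^+ k)%E) /\
  zeta_radius R (prod_map T1 T2) = (zeta_radius R T1 * zeta_radius R T2)%E.
Proof.
have [S1 [c1 [uS1 tS1 c10 uE1]]] := nondegenerate_power_sum nd1.
have [S2 [c2 [uS2 tS2 c20 uE2]]] := nondegenerate_power_sum nd2.
have expey k : (0 < k)%N -> (+oo ^+ k)%E = +oo%E :> \bar R.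
  case: k => // k _; elim: k => [|k IH]; first by rewrite expeS expe0 mule1.
  by rewrite expeS IH mulyy.
(* Without frequencies all fixed-point counts vanish and the radius is [+oo]; this case is treated
   apart throughout. *)
have zero X (T : X -> X) (c : R[i] -> R[i]) : (forall n, (0 < n)%N ->
    (fix_count T n)%:R = \sum_(a <- [::]) c a * a ^+ n :> R[i]) ->
    forall n, (0 < n)%N -> fix_count T n = 0%N.
  by move=> E n /E /eqP; rewrite big_nil pnatr_eq0 => /eqP.
have radius_zero (v : nat -> nat) : (forall n, (0 < n)%N -> v n = 0%N) ->
    ((root_limsup (fun n => (v n)%:R : R))^-1)%E = +oo%E.
  by move=> v0; rewrite root_limsup_eq0 ?inve0// => n n0; rewrite v0.
have radiusE X (T : X -> X) S (c : R[i] -> R[i]) a : uniq S ->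
    torsion_independent S -> {in S, forall a, c a != 0} ->
    (forall n, (0 < n)%N -> (fix_count T n)%:R = \sum_(a <- S) c a * a ^+ n) ->
    a \in S -> {in S, forall b, `|b| <= `|a|} ->
    0 < cabs a /\ zeta_radius R T = (cabs a)^-1%:E.
  move=> uS tS c0 uE aS amax.
  have a0 : 0 < cabs a.
    by rewrite -ltcR cabsE normr_gt0; case: tS => S0 _; apply: contraTneq aS => ->.
  (* The map itself is covered by the iterate formula with k = 1, hence the factor [1 * n]. *)
  split=> //; rewrite (@zeta_radiusE _ _ T (fun n => fix_count T (1 * n)%N)).
    by rewrite (root_limsup_iter _ uS tS c0 uE aS amax)// expr1 inver gt_eqF.
  by move=> n _; rewrite mul1n.
split=> [k k0|].
  rewrite (zeta_radiusE R (fun n => fix_count_iter fin1 k0 (n:=n))).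
  have [S1n|S1n] := eqVneq S1 [::].
    rewrite S1n in uE1; rewrite (zeta_radiusE R (fun n _ => erefl (fix_count T1 n))).
    rewrite !radius_zero ?expey// => n n0; apply: (zero _ _ _ uE1) => //.
    by rewrite muln_gt0 k0.
  have [a aS amax] := max_norm S1n.
  have [a0 ->] := radiusE _ _ _ _ _ uS1 tS1 c10 uE1 aS amax.
  rewrite (root_limsup_iter k0 uS1 tS1 c10 uE1 aS amax) inver gt_eqF ?exprn_gt0//.
  by rewrite -EFin_expe exprVn.
rewrite (zeta_radiusE R (fun n => fix_count_prod fin1 fin2 (n:=n))).
(* If one factor has no frequencies, its radius is [+oo] and the other radius is positive or [+oo],
   so both sides are [+oo]. *)
have [S1n|S1n] := eqVneq S1 [::].
  rewrite S1n in uE1; rewrite (zeta_radiusE R (fun n _ => erefl (fix_count T1 n))).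
  rewrite !radius_zero => [|n n0|n n0]; try by rewrite ?(zero _ _ _ uE1).
  have [S2n|S2n] := eqVneq S2 [::].
    rewrite S2n in uE2; rewrite (zeta_radiusE R (fun n _ => erefl (fix_count T2 n))).
    by rewrite radius_zero ?mulyy// => n n0; rewrite (zero _ _ _ uE2).
  have [b bS bmax] := max_norm S2n.
  have [b0 ->] := radiusE _ _ _ _ _ uS2 tS2 c20 uE2 bS bmax.
  by rewrite gt0_mulye// lte_fin invr_gt0.
have [a aS amax] := max_norm S1n.
have [a0 ->] := radiusE _ _ _ _ _ uS1 tS1 c10 uE1 aS amax.
have [S2n|S2n] := eqVneq S2 [::].
  rewrite S2n in uE2; rewrite (zeta_radiusE R (fun n _ => erefl (fix_count T2 n))).
  rewrite !radius_zero => [|n n0|n n0]; try by rewrite ?(zero _ _ _ uE2) ?muln0.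
  by rewrite gt0_muley// lte_fin invr_gt0.
have [b bS bmax] := max_norm S2n.
have [b0 ->] := radiusE _ _ _ _ _ uS2 tS2 c20 uE2 bS bmax.
rewrite (root_limsup_prod uS1 tS1 c10 uE1 aS amax uS2 tS2 c20 uE2 bS bmax).
by rewrite inver gt_eqF ?mulr_gt0// invfM EFinM.
Qed.
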